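(* Let $K\in\mathbb N$, $p_1,\dots,p_K>0$ with $\sum_k p_k=1$, $\sigma_1^2,\dots,\sigma_K^2>0$, and $\sigma_{\mathrm{glob}}^2=\sum_{k=1}^K p_k\sigma_k^2$. Let $Q(x)=\frac1{\sqrt2}(\operatorname{sign}(\operatorname{Re}x)+\mathrm j\operatorname{sign}(\operatorname{Im}x))$ and let $n\sim\mathcal N_{\mathbb C}(0,\eta^2)$, $\eta^2>0$. Let $\mathrm{MSE}_{\mathrm{GMM}}=\mathbb E[|h-\mathbb E[h\mid r]|^2]$ for $r=Q(h+n)$ with $h\sim\sum_k p_k\mathcal N_{\mathbb C}(0,\sigma_k^2)$ independent of $n$, and let $\mathrm{MSE}_{\mathrm{Gauss}}=\mathbb E[|g-\mathbb E[g\mid r']|^2]$ for $r'=Q(g+n)$ with $g\sim\mathcal N_{\mathbb C}(0,\sigma_{\mathrm{glob}}^2)$ independent of $n$. Then for every $\eta^2>0$, $$\mathrm{MSE}_{\mathrm{Gauss}}\le\mathrm{MSE}_{\mathrm{GMM}}.$$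
   Context: $\mathcal N_{\mathbb C}(0,\sigma^2)$ denotes the circularly symmetric complex Gaussian distribution with variance $\sigma^2$. The two MSEs are those of the respective conditional mean (MMSE) estimators, for signals with the same global variance. *)

(* Defs.v *)
From HB Require Import structures.
From mathcomp Require Import all_boot all_order all_algebra.
From mathcomp Require Import all_classical all_reals all_analysis.
Set Implicit Arguments. Unset Strict Implicit. Unset Printing Implicit Defensive.
Import Order.TTheory GRing.Theory Num.Theory.
Import numFieldNormedType.Exports.
Local Open Scope classical_set_scope.
Local Open Scope ring_scope.

(* A complex number x is represented by the pair (Re x, Im x) : R * R. *)

Section Defs.
Variable R : realType.

(* density on R^2 of N_C(0, s) : circularly symmetric complex Gaussian with
   variance s = E|x|^2 (Re and Im independent N(0, s/2)). *)
Definition cgauss_pdf (s : R) (x : R * R) : R :=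
  (pi * s)^-1 * expR (- (x.1 ^+ 2 + x.2 ^+ 2) / s).

Definition gmm_pdf (K : nat) (p sig : 'I_K -> R) (x : R * R) : R :=
  \sum_(k < K) p k * cgauss_pdf (sig k) x.

(* sign function; the value at 0 is irrelevant (probability-zero event) *)
Definition sgn (x : R) : R := if 0 <= x then 1 else -1.

Definition quant (x : R * R) : R * R :=
  (sgn x.1 / Num.sqrt 2, sgn x.2 / Num.sqrt 2).

(* joint sample space: z = (h, n) with h, n in C = R * R, Lebesgue measure *)
Definition leb2 := ((@lebesgue_measure R) \x (@lebesgue_measure R))%E.
Definition leb4 := (leb2 \x leb2)%E.

(* Expectation of f(h, n) where h has density dh and n ~ N_C(0, eta2),
   independent (joint density = product of the densities). *)
Definition expect (dh : R * R -> R) (eta2 : R) (f : (R * R) * (R * R) -> R)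
  : \bar R :=
  (\int[leb4]_z (f z * dh z.1 * cgauss_pdf eta2 z.2)%:E)%E.

Definition obs (z : (R * R) * (R * R)) : R * R :=
  quant (z.1.1 + z.2.1, z.1.2 + z.2.2).

Definition indic (b : bool) : R := if b then 1 else 0.

(* conditional mean E[h | r = q] (r takes finitely many values), componentwise *)
Definition cond_mean (dh : R * R -> R) (eta2 : R) (q : R * R) : R * R :=
  let P := fine (expect dh eta2 (fun z => indic (obs z == q))) in
  (fine (expect dh eta2 (fun z => z.1.1 * indic (obs z == q))) / P,
   fine (expect dh eta2 (fun z => z.1.2 * indic (obs z == q))) / P).

Definition mmse (dh : R * R -> R) (eta2 : R) : \bar R :=
  expect dh eta2 (fun z =>
    (z.1.1 - (cond_mean dh eta2 (obs z)).1) ^+ 2 +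
    (z.1.2 - (cond_mean dh eta2 (obs z)).2) ^+ 2).

End Defs.

(* Main.v *)
(* Given r = Q(h + n), the conditional mean of h is kappa (sgn y1, sgn y2) with
   y = h + n and kappa = E[h1 sgn y1], so that MSE = E|h|^2 - 2 kappa^2.  Both
   E|h|^2 and kappa are linear in the law of h, and for h ~ N_C(0, s) one finds
   E|h|^2 = s and kappa = s / sqrt (pi (s + eta2)).  Hence the two laws share
   E|h|^2, while kappa is larger for the Gaussian one by Jensen's inequality,
   s / sqrt (s + eta2) being concave in s. *)

Require Import Defs.
From HB Require Import structures.
From mathcomp Require Import all_boot all_order all_algebra.
From mathcomp Require Import all_classical all_reals all_analysis.
From mathcomp Require Import measurable_realfun ring lra.
Set Implicit Arguments.
Unset Strict Implicit.
Unset Printing Implicit Defensive.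
Import Order.TTheory GRing.Theory Num.Theory.
Import numFieldNormedType.Exports.
Local Open Scope classical_set_scope.
Local Open Scope ring_scope.

(** * Integrability and value of an integral, carried together *)

(** Bundling integrability with a real value lets linearity and Fubini be chained without reproving
    side conditions. *)
Definition has_integral d (T : measurableType d) (R : realType)
    (mu : {measure set T -> \bar R}) (f : T -> R) (v : R) :=
  mu.-integrable [set: T] (EFin \o f) /\ (\int[mu]_x (f x)%:E = v%:E)%E.

Section has_integral_theory.
Context d (T : measurableType d) (R : realType).
Variable mu : {measure set T -> \bar R}.
Implicit Types (f g : T -> R) (v w : R).

Lemma has_integral_eq f g v w : has_integral mu f v -> f =1 g -> v = w ->
  has_integral mu g w.
Proof. by move=> fv /funext <- <-. Qed.

Lemma has_integralD f g v w : has_integral mu f v -> has_integral mu g w ->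
  has_integral mu (fun x => f x + g x) (v + w).
Proof.
move=> [fi fv] [gi gw]; split; first exact: (integrableD measurableT fi gi).
under eq_integral do rewrite EFinD.
by rewrite integralD_EFin// fv gw.
Qed.

Lemma has_integralZ f v (c : R) : has_integral mu f v ->
  has_integral mu (fun x => c * f x) (c * v).
Proof.
move=> [fi fv]; split; first exact: (integrableZl measurableT c fi).
under eq_integral do rewrite EFinM.
by rewrite integralZl// fv.
Qed.

Lemma has_integral0 : has_integral mu (fun=> 0) 0.
Proof. by split; [exact: integrable0|rewrite integral0]. Qed.

Lemma has_integral_sum (I : Type) (s : seq I) (F : I -> T -> R) (V : I -> R) :
  (forall i, has_integral mu (F i) (V i)) ->
  has_integral mu (fun x => \sum_(i <- s) F i x) (\sum_(i <- s) V i).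
Proof.
move=> FV; elim: s => [|i s IH].
  by apply: has_integral_eq has_integral0 _ _ => [x|]; rewrite big_nil.
by apply: has_integral_eq (has_integralD (FV i) IH) _ _ => [x|];
  rewrite big_cons.
Qed.

(** Supplies existence only; the value is identified afterwards, by symmetry or by iterated
    integration. *)
Lemma has_integral_dominated f g w : measurable_fun [set: T] f ->
  has_integral mu g w -> (forall x, `|f x| <= g x) ->
  exists v, has_integral mu f v.
Proof.
move=> mf [gi gw] fg.
have fi : mu.-integrable [set: T] (EFin \o f).
  apply: le_integrable gi => //; first exact/measurable_EFinP.
  by move=> x _ /=; rewrite lee_fin (le_trans (fg x))// ler_norm.
exists (fine (\int[mu]_x (f x)%:E)%E); split => //.
by rewrite fineK//; exact: integrable_fin_num fi.
Qed.

Lemma has_integral_measurable f v : has_integral mu f v ->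
  measurable_fun [set: T] f.
Proof. by case=> /measurable_int/measurable_EFinP. Qed.

Lemma has_integral_norm f v : has_integral mu f v ->
  exists w, has_integral mu (fun x => `|f x|) w.
Proof.
move=> [fi _]; have nfi := integrable_norm fi.
exists (fine (\int[mu]_x (`|f x|)%:E)%E); split => //.
by rewrite fineK//; exact: integrable_fin_num nfi.
Qed.

Lemma has_integral_ge0 f v : measurable_fun [set: T] f ->
  (forall x, 0 <= f x) -> (\int[mu]_x (f x)%:E = v%:E)%E ->
  has_integral mu f v.
Proof.
move=> mf f0 fv; split => //; apply/integrableP; split.
  exact/measurable_EFinP.
under eq_integral do rewrite /= ger0_norm//.
by rewrite fv ltry.
Qed.

End has_integral_theory.

(** * Fubini on product spaces *)

Section has_integral_prod.
Context d1 d2 (T1 : measurableType d1) (T2 : measurableType d2) (R : realType).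
Variable m1 : {sigma_finite_measure set T1 -> \bar R}.
Variable m2 : {sigma_finite_measure set T2 -> \bar R}.

Lemma has_integral_iterated (f : T1 * T2 -> R) (phi : T1 -> R) (w : R) :
  (m1 \x m2)%E.-integrable [set: T1 * T2] (EFin \o f) ->
  (forall x, has_integral m2 (fun y => f (x, y)) (phi x)) ->
  has_integral m1 phi w -> has_integral (m1 \x m2)%E f w.
Proof.
move=> fi fphi [_ phiw]; split => //.
rewrite -(integral12_prod_meas1 fi) -phiw.
by apply: eq_integral => x _; case: (fphi x).
Qed.

Lemma has_integral_iterated_sym (f : T1 * T2 -> R) (phi : T2 -> R) (w : R) :
  (m1 \x m2)%E.-integrable [set: T1 * T2] (EFin \o f) ->
  (forall y, has_integral m1 (fun x => f (x, y)) (phi y)) ->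
  has_integral m2 phi w -> has_integral (m1 \x m2)%E f w.
Proof.
move=> fi fphi [_ phiw]; split => //.
rewrite -(integral21_prod_meas1 fi) -phiw.
by apply: eq_integral => x _; case: (fphi x).
Qed.

Lemma has_integral_iterated_inv (f : T1 * T2 -> R) (phi : T1 -> R) (w : R) :
  has_integral (m1 \x m2)%E f w ->
  (forall x, has_integral m2 (fun y => f (x, y)) (phi x)) ->
  has_integral m1 phi w.
Proof.
move=> [fi fw] fphi.
have E : (fun x => \int[m2]_y (EFin \o f) (x, y))%E = EFin \o phi.
  by apply/funext => x; case: (fphi x).
split; first by rewrite -E; exact: integrable_fubini_F.
by rewrite -fw -(integral12_prod_meas1 fi); apply: eq_integral => x _; case: (fphi x).
Qed.

Lemma has_integral_prod (f : T1 -> R) (g : T2 -> R) (v w : R) :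
  has_integral m1 f v -> has_integral m2 g w ->
  has_integral (m1 \x m2)%E (fun z => f z.1 * g z.2) (v * w).
Proof.
move=> fv gw.
have mf := has_integral_measurable fv.
have mg := has_integral_measurable gw.
have mfg : measurable_fun [set: T1 * T2] (fun z => f z.1 * g z.2).
  by apply: measurable_funM; apply: measurableT_comp.
apply: (@has_integral_iterated _ (fun x => f x * w)).
(* Joint integrability by Tonelli: the iterated integral of the absolute value is the product of
   those of [|f|] and [|g|]. *)
- apply/integrable12ltyP; first exact/measurable_EFinP.
  have [v' [fi fv']] := has_integral_norm fv.
  have [w' [gi gw']] := has_integral_norm gw.
  rewrite [ltLHS](_ : _ = (v' * w')%:E) ?ltry// mulrC EFinM -fv'.
  rewrite -integralZl//; apply: eq_integral => x _.
  under eq_integral do rewrite /= normrM EFinM.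
  by rewrite integralZl// gw' muleC.
- by move=> x; exact: (has_integralZ (f x) gw).
- by apply: has_integral_eq (has_integralZ w fv) _ _ => [x|]; rewrite mulrC.
Qed.

End has_integral_prod.

(** * Reflection and exceptional points on the real line *)

Section line.
Variable R : realType.
Local Notation mu := (@lebesgue_measure R).
Implicit Types (f g : R -> R) (v w s x : R).

Lemma ge0_integral_reflection (f : R -> \bar R) : measurable_fun [set: R] f ->
  (forall x, (0 <= f x)%E) -> (\int[mu]_x f (- x)%R = \int[mu]_x f x)%E.
Proof.
move=> mf f0.
transitivity (\int[pushforward mu (-%R : _ -> measurableTypeR R)]_x f x)%E.
  by rewrite ge0_integral_pushforward.
by apply: eq_measure_integral => A mA _; exact: lebesgue_measureN.
Qed.

Lemma has_integral_reflection f v :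
  has_integral mu f v -> has_integral mu (fun x => f (- x)) v.
Proof.
move=> fv; have mf := has_integral_measurable fv.
have mfN : measurable_fun [set: R] (fun x => f (- x)).
  exact: measurableT_comp.
have fiN : mu.-integrable [set: R] (EFin \o (fun x => f (- x))).
  apply/integrableP; split; first exact/measurable_EFinP.
  (* The nonnegative case, applied to [|f|], gives the integrability that the signed change of
     variables requires. *)
  rewrite (ge0_integral_reflection (f := fun x => `|f x|%:E))//.
    by have /integrableP[] := fv.1.
  exact/measurable_EFinP/measurableT_comp.
split=> //; rewrite -(fv.2).
transitivity (\int[pushforward mu (-%R : _ -> measurableTypeR R)]_x (f x)%:E)%E.
  by rewrite integral_pushforward//; exact/measurable_EFinP.
by apply: eq_measure_integral => A mA _; exact: lebesgue_measureN.
Qed.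

(** The sum of [f] and its reflection vanishes identically and has integral [2 v]. *)
Lemma has_integral_odd f v :
  has_integral mu f v -> (forall x, f (- x) = - f x) -> v = 0.
Proof.
move=> fv fN; have [_ +] := has_integralD fv (has_integral_reflection fv).
under eq_integral do rewrite fN subrr.
by rewrite integral0 => -[/eqP]; rewrite eq_sym -mulr2n mulrn_eq0 => /eqP.
Qed.

(** A point is Lebesgue-null. This absorbs the convention [sgn 0 = 1], which breaks the oddness of
    [sgn] at the origin. *)
Lemma has_integral_except f g v (a : R) : has_integral mu f v ->
  measurable_fun [set: R] g -> (forall x, x != a -> f x = g x) ->
  has_integral mu g v.
Proof.
move=> fv mg fg; have mf := has_integral_measurable fv.
have aefg : ae_eq mu [set: R] (EFin \o f) (EFin \o g).
  exists [set a]; split; [exact: measurable_set1|exact: lebesgue_measure_set1|].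
  move=> x /= /not_implyP[_ nfg]; apply/eqP/negPn/negP => /fg fgx.
  by apply: nfg; rewrite fgx.
split; last first.
  by rewrite -(fv.2); apply: ae_eq_integral => //; try exact/measurable_EFinP;
    exact: ae_eq_sym.
apply/integrableP; split; first exact/measurable_EFinP.
have /integrableP[_] := fv.1; congr (_ < _)%E.
apply: ae_eq_integral => //; first by apply/measurable_EFinP/measurableT_comp.
- by apply/measurable_EFinP/measurableT_comp.
- by apply: filterS aefg => x /= fgx Dx; have [->] := fgx Dx.
Qed.

(** * The real Gaussian density and its first-moment tails *)

(** The law N(0, s/2) of one real coordinate of N_C(0, s); [s] is the variance of the complex
    variable. *)
Definition gauss_pdf (s x : R) : R := (Num.sqrt (pi * s))^-1 * expR (- x ^+ 2 / s).

Lemma gauss_normal_pdf s : 0 < s -> gauss_pdf s = normal_pdf 0 (Num.sqrt (s / 2)).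
Proof.
move=> s0; rewrite normal_pdfE; last by rewrite gt_eqF// sqrtr_gt0 divr_gt0.
apply/funext => x; rewrite /gauss_pdf /normal_peak /normal_fun subr0.
rewrite sqr_sqrtr; last by rewrite divr_ge0// ltW.
have -> : s / 2 *+ 2 = s by rewrite -mulr_natr divfK.
by have -> : s / 2 * pi *+ 2 = pi * s by rewrite mulrAC -mulr_natr divfK// mulrC.
Qed.

Lemma measurable_gauss s : measurable_fun [set: R] (gauss_pdf s).
Proof.
apply: measurable_funM => //; apply: measurableT_comp => //.
by apply: measurable_funM => //; apply: measurableT_comp => //; exact: measurable_funX.
Qed.

Lemma gauss_ge0 s x : 0 <= gauss_pdf s x.
Proof. by rewrite mulr_ge0 ?expR_ge0// invr_ge0 sqrtr_ge0. Qed.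

Lemma gaussN s x : gauss_pdf s (- x) = gauss_pdf s x.
Proof. by rewrite /gauss_pdf sqrrN. Qed.

Lemma gauss_norm s x : gauss_pdf s `|x| = gauss_pdf s x.
Proof. by rewrite /gauss_pdf real_normK// num_real. Qed.

Lemma has_integral_gauss s : 0 < s -> has_integral mu (gauss_pdf s) 1.
Proof.
move=> s0; rewrite gauss_normal_pdf//; split; first exact: integrable_normal_pdf.
exact: integral_normal_pdf.
Qed.

Lemma cgauss_pdfE s z : 0 < s -> cgauss_pdf s z = gauss_pdf s z.1 * gauss_pdf s z.2.
Proof.
move=> s0; rewrite /cgauss_pdf /gauss_pdf mulrACA -expRD -invfM -expr2 sqr_sqrtr.
  by rewrite -mulrDl opprD.
by rewrite mulr_ge0// ?pi_ge0// ltW.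
Qed.

Lemma is_derive_gauss s x :
  is_derive (x : R) (1 : R) (gauss_pdf s) (- (2 / s) * (x * gauss_pdf s x)).
Proof.
by rewrite /gauss_pdf; apply: is_derive_eq; rewrite /GRing.scale/=; ring.
Qed.

Lemma cvg_gauss s : 0 < s -> gauss_pdf s x @[x --> +oo] --> (0 : R).
Proof.
move=> s0; rewrite -[X in _ --> X](mulr0 (Num.sqrt (pi * s))^-1).
apply: cvgM; first exact: cvg_cst.
have -> : (fun x => expR (- x ^+ 2 / s)) = gauss_fun \o (fun x => x * (Num.sqrt s)^-1).
  apply/funext => x /=; rewrite /gauss_fun exprMn exprVn sqr_sqrtr ?mulNr//.
  exact: ltW.
apply: cvg_comp (@cvg_gauss_fun R).
by apply/gt0_cvgMly; rewrite ?invr_gt0 ?sqrtr_gt0//.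
Qed.

(** The integrand has antiderivative [- (s / 2) * gauss_pdf s x], which vanishes at infinity. *)
Lemma gauss_tail s a : 0 < s -> 0 <= a ->
  has_integral mu (fun x => if a <= x then x * gauss_pdf s x else 0)
    (s / 2 * gauss_pdf s a).
Proof.
move=> s0 a0.
have cgs : continuous (gauss_pdf s).
  rewrite gauss_normal_pdf//; apply: continuous_normal_pdf.
  by rewrite gt_eqF// sqrtr_gt0 divr_gt0.
apply: has_integral_ge0.
- apply: measurable_fun_ifT => //=; first exact: measurable_fun_ler.
  by apply: measurable_funM => //; exact: measurable_gauss.
- by move=> x; case: ifPn => // ax; rewrite mulr_ge0 ?gauss_ge0// (le_trans a0).
rewrite (_ : (\int[mu]_x _ =
    \int[mu]_(x in `[a, +oo[) (x * gauss_pdf s x)%:E)%E); last first.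
  rewrite [RHS]integral_mkcond; apply: eq_integral => x _.
  rewrite patchE mem_setE in_itv/= andbT.
  by case: ifPn.
rewrite (ge0_continuous_FTC2y (F := fun x => - (s / 2) * gauss_pdf s x) (l := 0)).
- by rewrite sub0e -EFinN mulNr opprK.
- by move=> x ax; rewrite mulr_ge0 ?gauss_ge0// (le_trans a0).
- by apply: continuous_subspaceT => x; apply: cvgM; [exact: cvg_id|exact: cgs].
- rewrite -[X in _ --> X](mulr0 (- (s / 2))); apply: cvgM.
    exact: cvg_cst.
  exact: cvg_gauss.
- move=> x _; have ? := is_derive_gauss s x; exact: derivableM.
- by apply: cvg_at_right_filter; apply: cvgM; [exact: cvg_cst|exact: cgs].
- move=> x _; have ? := is_derive_gauss s x.
  rewrite derive1E deriveM// derive_cst derive_val scaler0 addr0/GRing.scale/=.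
  by field; rewrite gt_eqF.
Qed.
End line.

(** * Gaussian moments and the correlation with a shifted sign *)

Section gauss_moments.
Variable R : realType.
Local Notation mu := (@lebesgue_measure R).
Implicit Types (f g : R -> R) (v w s e x : R).

Lemma gauss_abs_tail s a : 0 < s -> 0 <= a ->
  has_integral mu (fun x => if a <= `|x| then `|x| * gauss_pdf s x else 0)
    (s * gauss_pdf s a).
Proof.
move=> s0 a0; have T := gauss_tail s0 a0.
apply: has_integral_eq (has_integralD T (has_integral_reflection T)) _ _; last first.
  by field.
move=> x /=; rewrite gaussN; have [x0|x0] := ger0P x.
  case: (ifP (a <= - x)) => [ax|_]; last by rewrite addr0.
  (* The two half-lines can meet only at the origin, where both integrands are zero. *)
  have -> : x = 0 by apply/le_anti; rewrite x0 -oppr_ge0 (le_trans a0 ax).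
  by rewrite !(mulr0, mul0r, oppr0, addr0) !if_same.
rewrite (ifF (b := a <= x)) ?add0r ?mulNr//.
apply/negbTE; rewrite -ltNge; exact: lt_le_trans a0.
Qed.

Lemma gauss_dominated s f : 0 < s -> measurable_fun [set: R] f ->
  (forall x, `|f x| <= `|x|) ->
  exists v, has_integral mu (fun x => f x * gauss_pdf s x) v.
Proof.
move=> s0 mf fx; apply: has_integral_dominated (gauss_abs_tail s0 (lexx 0)) _.
  by apply: measurable_funM => //; exact: measurable_gauss.
by move=> x; rewrite normr_ge0 normrM (ger0_norm (gauss_ge0 _ _)) ler_wpM2r// gauss_ge0.
Qed.

Lemma gauss_mean s : 0 < s -> has_integral mu (fun x => x * gauss_pdf s x) 0.
Proof.
move=> s0; have [//|//|v xv] := @gauss_dominated s id s0.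
by rewrite -(has_integral_odd xv)// => x; rewrite gaussN mulNr.
Qed.

(* Tonelli: x^2 = |x| * \int_(|t| <= |x|) dt / 2 *)
Lemma gauss_var s : 0 < s -> has_integral mu (fun x => x ^+ 2 * gauss_pdf s x) (s / 2).
Proof.
move=> s0; apply: has_integral_ge0.
- by apply: measurable_funM; [exact: measurable_funX|exact: measurable_gauss].
- by move=> x; rewrite mulr_ge0 ?sqr_ge0 ?gauss_ge0.
pose F (z : R * R) : \bar R :=
  (2^-1 * (if `|z.2| <= `|z.1| then `|z.1| * gauss_pdf s z.1 else 0))%:E.
have mF : measurable_fun [set: R * R] F.
  apply/measurable_EFinP/measurable_funM => //.
  apply: measurable_fun_ifT => //=.
    by apply: measurable_fun_ler; apply: measurableT_comp.
  apply: measurable_funM; first exact: measurableT_comp.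
  by apply: measurableT_comp => //; exact: measurable_gauss.
have F0 z : (0 <= F z)%E.
  by rewrite lee_fin mulr_ge0//; case: ifP => // _; rewrite mulr_ge0 ?gauss_ge0.
transitivity (\int[mu]_x \int[mu]_t F (x, t))%E.
  apply: eq_integral => x _; rewrite /F/=.
  transitivity (\int[mu]_t ((2^-1 * (`|x| * gauss_pdf s x))%:E *
      (\1_(`[- `|x|, `|x|] : set R) t)%:E))%E.
    rewrite integralZl; last 2 first.
    - by [].
    - exact: integrable_indic_itv.
    rewrite integral_indic//= setIT lebesgue_measure_itv/= lte_fin.
    case: ltP => xx.
      rewrite -EFinB -EFinM; congr EFin.
      have -> : x ^+ 2 = `|x| ^+ 2 by rewrite real_normK// num_real.
      by field.
    have -> : x = 0.
      by apply/normr0_eq0/le_anti; rewrite normr_ge0 andbT; move: xx; lra.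
    by rewrite expr0n/= mul0r mule0.
  apply: eq_integral => t _; rewrite -EFinM indicE mem_setE in_itv/= -ler_norml.
  by case: ifP => _; rewrite ?mulr1 ?mulr0.
(* After the swap, the inner integral over [x] is half the absolute tail from [|t|], namely
   [s / 2 * gauss_pdf s t]. *)
rewrite fubini_tonelli//.
transitivity (\int[mu]_t (s / 2 * gauss_pdf s t)%:E)%E.
  apply: eq_integral => t _; rewrite /F/=.
  have [_ ->] := has_integralZ 2^-1 (gauss_abs_tail s0 (normr_ge0 t)).
  by rewrite gauss_norm mulrA [2^-1 * s]mulrC.
by have [_ ->] := has_integralZ (s / 2) (has_integral_gauss s0); rewrite mulr1.
Qed.

Lemma measurable_sgn : measurable_fun [set: R] (@sgn R).
Proof. by apply: measurable_fun_ifT => //=; exact: measurable_fun_ler. Qed.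

Lemma normr_sgn x : `|sgn x| = 1.
Proof. by rewrite /sgn; case: ifP; rewrite ?normrN normr1. Qed.

Lemma sgn_sqr x : sgn x * sgn x = 1.
Proof. by rewrite /sgn; case: ifP => _; rewrite ?mulrNN mulr1. Qed.

Lemma sgnN x : x != 0 -> sgn (- x) = - sgn x.
Proof.
by rewrite /sgn oppr_ge0; case: (ltgtP x 0) => //= _ _; rewrite opprK.
Qed.

(* The part of x sgn(x + n) supported on |x| < |n| is odd in x. *)
Lemma gauss_mul_sgn s n : 0 < s ->
  has_integral mu (fun x => x * sgn (x + n) * gauss_pdf s x) (s * gauss_pdf s n).
Proof.
move=> s0.
have mf : measurable_fun [set: R] (fun x => x * sgn (x + n)).
  apply: measurable_funM => //.
  by apply: measurableT_comp; [exact: measurable_sgn|exact: measurable_funD].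
have [|v fv] := gauss_dominated s0 mf.
  by move=> x; rewrite normrM normr_sgn mulr1.
(* Where [|n| <= |x|], the sign of [x + n] is that of [x] except at [x = - n], so the integrand
   there is the absolute tail. Subtracting it leaves the odd part [g], hence [v] equals the tail
   integral. *)
have fv' := has_integralD fv (has_integralZ (-1) (gauss_abs_tail s0 (normr_ge0 n))).
pose g x := if `|x| < `|n| then x * sgn n * gauss_pdf s x else 0.
have mg : measurable_fun [set: R] g.
  apply: measurable_fun_ifT => //=.
    by apply: measurable_fun_ltr => //; exact: measurableT_comp.
  by apply: measurable_funM; [exact: measurable_funM|exact: measurable_gauss].
suff : v + -1 * (s * gauss_pdf s `|n|) = 0 by rewrite gauss_norm mulN1r => /subr0_eq <-.
have gv : has_integral mu g (v + -1 * (s * gauss_pdf s `|n|)).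
  apply: (has_integral_except (a := - n) fv' mg) => x xn.
  rewrite /g leNgt; case: ltP => /= xn'; last first.
    rewrite mulN1r -mulrBl (_ : _ - _ = 0) ?mul0r//.
    rewrite /sgn; case: ifPn => xn0.
      rewrite mulr1; apply/eqP; rewrite subr_eq0 eq_sym; apply/eqP/ger0_norm.
      rewrite leNgt; apply/negP => x0; move: xn'; rewrite (ltr0_norm x0).
      by rewrite real_ler_norml ?num_real//; move: xn => /eqP xn; lra.
    rewrite mulrN1; apply/eqP; rewrite subr_eq0 eq_sym; apply/eqP/ler0_norm.
    rewrite leNgt; apply/negP => x0; move: xn' xn0; rewrite (gtr0_norm x0).
    by rewrite real_ler_norml ?num_real//; lra.
  rewrite mulr0 addr0; congr (_ * _ * _).
  rewrite /sgn; move: xn'; have [n0|n0] := leP 0 n.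
    by rewrite (ger0_norm n0) real_ltr_norml ?num_real// => xn'; rewrite ifT//; lra.
  rewrite (ltr0_norm n0) real_ltr_norml ?num_real// => xn'.
  by rewrite ifF//; apply/negbTE; rewrite -ltNge; lra.
apply: has_integral_odd gv _ => x; rewrite /g normrN gaussN.
by case: ifP; rewrite ?oppr0// !mulNr.
Qed.

(** Adding the exponents gives [1/s + 1/e = (s + e)/(s e)], so the product is a constant times the
    density with parameter [s e/(s + e)]; the constant is the value. *)
Lemma gauss_mul_gauss s e : 0 < s -> 0 < e ->
  has_integral mu (fun x => gauss_pdf s x * gauss_pdf e x) (Num.sqrt (pi * (s + e)))^-1.
Proof.
move=> s0 e0; have se : 0 < s + e by rewrite addr_gt0.
have t0 : 0 < s * e / (s + e) by rewrite divr_gt0// mulr_gt0.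
apply: has_integral_eq (has_integralZ _ (has_integral_gauss t0)) _ (mulr1 _) => x.
rewrite /gauss_pdf [RHS]mulrACA -expRD [LHS]mulrA -!invfM; congr (_^-1 * expR _).
  rewrite -!sqrtrM ?mulr_ge0 ?pi_ge0 ?(ltW s0) ?(ltW se)//; congr Num.sqrt.
  by field; rewrite gt_eqF.
by field; rewrite !gt_eqF.
Qed.

End gauss_moments.

(* The library's sigma-finiteness instance on products is shadowed by the one
   for subprobabilities, hence the instance on leb2. *)
HB.instance Definition _ (R : realType) := Measure.on (@leb2 R).
Lemma leb2_sigma_finite (R : realType) : sigma_finite setT (@leb2 R).
Proof.
pose I (n : nat) := [set` `[- n%:R, n%:R : R]].
exists (fun n => I n `*` I n).
  apply/esym/seteqP; split => // -[x y] _.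
  exists (Num.truncn (Num.max `|x| `|y|)).+1 => //.
  have := truncnS_gt (Num.max `|x| `|y|); rewrite gt_max => /andP[/ltW xn /ltW yn].
  by split; rewrite /I/= in_itv/= -ler_norml.
move=> n; split; first by apply: measurableX; exact: measurable_itv.
rewrite /leb2 product_measure1E; try exact: measurable_itv.
have finI : (lebesgue_measure (I n) < +oo)%E.
  by rewrite lebesgue_measure_itv; case: ifP; rewrite ltry.
by apply: lte_mul_pinfty => //; rewrite ge0_fin_numE.
Qed.
HB.instance Definition _ (R : realType) := Measure_isSigmaFinite.Build _ _ _ (@leb2 R)
  (@leb2_sigma_finite R).
HB.instance Definition _ (R : realType) := Measure.on (@leb4 R).

(** * Expectations over one real coordinate of signal and noise *)

Section gauss_factor.
Variables (R : realType) (s e : R).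
Hypotheses (s0 : 0 < s) (e0 : 0 < e).
Local Notation mu := (@lebesgue_measure R).
Implicit Types (f : R * R -> R) (v w : R).

(** The bound involves only the signal coordinate [z.1]. It covers [1], [x] and [x ^+ 2], also
    multiplied by signs, and is integrable thanks to the Gaussian second moment. *)
Definition quadratic_growth f :=
  measurable_fun [set: R * R] f /\ forall z, `|f z| <= 1 + z.1 ^+ 2.

(** [v] is the mean of [f] at an independent pair: a signal coordinate of law N(0, s/2) and a noise
    coordinate of law N(0, e/2). *)
Definition pair_expect f v :=
  has_integral (@leb2 R) (fun z => f z * (gauss_pdf s z.1 * gauss_pdf e z.2)) v.

Let has_integral_growth :
  has_integral mu (fun x : R => (1 + x ^+ 2) * gauss_pdf s x) (1 + s / 2).
Proof.
apply: has_integral_eq (has_integralD (has_integral_gauss s0) (gauss_var s0)) _ erefl.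
by move=> x; rewrite mulrDl mul1r.
Qed.

Let weight_ge0 (z : R * R) : 0 <= gauss_pdf s z.1 * gauss_pdf e z.2.
Proof. by rewrite mulr_ge0 ?gauss_ge0. Qed.

Let measurable_weight : measurable_fun [set: R * R]
  (fun z => gauss_pdf s z.1 * gauss_pdf e z.2).
Proof.
by apply: measurable_funM; apply: measurableT_comp => //; exact: measurable_gauss.
Qed.

Lemma pair_expect_exists f : quadratic_growth f -> exists v, pair_expect f v.
Proof.
move=> [mf fb].
apply: has_integral_dominated (has_integral_prod has_integral_growth
  (has_integral_gauss e0)) _.
  exact: measurable_funM.
by move=> z /=; rewrite normrM (ger0_norm (weight_ge0 _)) -mulrA ler_wpM2r.
Qed.

(** [phi x] is the mean over the noise with the signal fixed at [x]. It is finite at every [x],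
    since [f] is bounded in the noise variable. *)
Lemma pair_expect_marginal f : quadratic_growth f ->
  exists phi : R -> R,
    (forall x, has_integral mu (fun n => f (x, n) * gauss_pdf e n) (phi x)) /\
    forall v, pair_expect f v -> has_integral mu (fun x => phi x * gauss_pdf s x) v.
Proof.
move=> [mf fb].
have /choice[phi phiE] : forall x, exists y,
    has_integral mu (fun n => f (x, n) * gauss_pdf e n) y.
  move=> x; apply: has_integral_dominated
      (has_integralZ (1 + x ^+ 2) (has_integral_gauss e0)) _.
    apply: measurable_funM; last exact: measurable_gauss.
    by apply: measurableT_comp => //; exact: measurable_pair1.
  by move=> n; rewrite normrM (ger0_norm (gauss_ge0 _ _)) ler_wpM2r ?gauss_ge0//
    (fb (x, n)).
exists phi; split => // v fv; apply: has_integral_iterated_inv fv _ => x /=.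
apply: has_integral_eq (has_integralZ (gauss_pdf s x) (phiE x)) _ (mulrC _ _) => n.
by rewrite mulrCA mulrA.
Qed.

Lemma pair_expect_fst (g : R -> R) v :
  has_integral mu (fun x => g x * gauss_pdf s x) v -> pair_expect (fun z => g z.1) v.
Proof.
move=> gv; apply: has_integral_eq (has_integral_prod gv (has_integral_gauss e0)) _ (mulr1 _).
by move=> z /=; rewrite mulrA.
Qed.

Let measurable_sgn_sum : measurable_fun [set: R * R] (fun z => sgn (z.1 + z.2)).
Proof.
apply: measurableT_comp; first exact: measurable_sgn.
exact: measurable_funD.
Qed.

Lemma quadratic_growth1 : quadratic_growth (fun=> 1).
Proof. by split=> // z; rewrite normr1 lerDl sqr_ge0. Qed.

Lemma quadratic_growth_fst : quadratic_growth (fun z => z.1).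
Proof.
split=> [|z]; first exact: measurable_fst.
rewrite -[z.1 ^+ 2](real_normK (num_real _)).
by have := sqr_ge0 (`|z.1| - 1); rewrite sqrrB1; have := normr_ge0 z.1; lra.
Qed.

Lemma quadratic_growth_sqr : quadratic_growth (fun z => z.1 ^+ 2).
Proof.
split=> [|z]; first by apply: measurable_funX.
by rewrite ger0_norm ?sqr_ge0// lerDr.
Qed.

Lemma quadratic_growth_mul_sgn f : quadratic_growth f ->
  quadratic_growth (fun z => f z * sgn (z.1 + z.2)).
Proof.
move=> [mf fb]; split=> [|z]; first exact: measurable_funM.
by rewrite normrM normr_sgn mulr1.
Qed.

Lemma pair_expect1 : pair_expect (fun=> 1) 1.
Proof.
apply: (@pair_expect_fst (fun=> 1)); apply: has_integral_eq (has_integral_gauss s0) _ erefl.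
by move=> x; rewrite mul1r.
Qed.

Lemma pair_expect_mean : pair_expect (fun z => z.1) 0.
Proof. exact: (@pair_expect_fst id _ (gauss_mean s0)). Qed.

Lemma pair_expect_var : pair_expect (fun z => z.1 ^+ 2) (s / 2).
Proof. exact: (@pair_expect_fst (fun x => x ^+ 2) _ (gauss_var s0)). Qed.

(** By symmetry of the noise, the mean of [sgn (x + n)] over [n] is odd in [x], and the signal
    density is even. *)
Lemma pair_expect_sgn : pair_expect (fun z => sgn (z.1 + z.2)) 0.
Proof.
have tsgn : quadratic_growth (fun z => sgn (z.1 + z.2)).
  split=> // z; rewrite normr_sgn lerDl; exact: sqr_ge0.
have [v sv] := pair_expect_exists tsgn.
have [phi [phiE phiv]] := pair_expect_marginal tsgn.
rewrite -(has_integral_odd (phiv _ sv))// => x; rewrite gaussN -mulNr; congr (_ * _).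
have refl : has_integral mu (fun n : R => sgn (x + n) * gauss_pdf e n) (- phi (- x)).
  (* The point [n = - x] is excluded because [x + n] vanishes there and [sgn] is not odd at zero. *)
  rewrite -mulN1r; apply: (has_integral_except (a := - x)
    (has_integralZ (-1) (has_integral_reflection (phiE (- x))))).
  - exact: (has_integral_measurable (phiE x)).
  - move=> n nx /=; rewrite gaussN mulN1r -opprD sgnN ?mulNr ?opprK//.
    by rewrite addrC addr_eq0.
have [_ xE] := phiE x; have [_] := refl; rewrite xE => -[->].
by rewrite opprK.
Qed.

(** Integrating over the signal first gives [s * gauss_pdf s n] for each noise value [n]; the rest
    is an integral of a product of two Gaussian densities. *)
Lemma pair_expect_corr :
  pair_expect (fun z => z.1 * sgn (z.1 + z.2)) (s / Num.sqrt (pi * (s + e))).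
Proof.
have [v [iv _]] := pair_expect_exists (quadratic_growth_mul_sgn quadratic_growth_fst).
apply: has_integral_iterated_sym iv _ (has_integralZ s (gauss_mul_gauss s0 e0)) => n /=.
apply: has_integral_eq (has_integralZ (gauss_pdf e n) (gauss_mul_sgn n s0)) _ _ => [x|].
  by ring.
by ring.
Qed.

(* The four real coordinates split into the independent pairs (Re h, Re n)
   and (Im h, Im n). *)
Lemma has_integral_pairs f1 f2 v1 v2 :
  quadratic_growth f1 -> quadratic_growth f2 ->
  pair_expect f1 v1 -> pair_expect f2 v2 ->
  has_integral (@leb4 R)
    (fun z => f1 (z.1.1, z.2.1) * f2 (z.1.2, z.2.2) *
      cgauss_pdf s z.1 * cgauss_pdf e z.2) (v1 * v2).
Proof.
move=> g1 g2 e1 e2.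
have [phi1 [phi1E phi1v]] := pair_expect_marginal g1.
have [phi2 [phi2E phi2v]] := pair_expect_marginal g2.
have [mf1 b1] := g1; have [mf2 b2] := g2.
have U : has_integral (@leb2 R) _ _ :=
  has_integral_prod has_integral_growth has_integral_growth.
have V : has_integral (@leb2 R) _ _ :=
  has_integral_prod (has_integral_gauss e0) (has_integral_gauss e0).
set F := (F in has_integral _ F).
have FE z : F z = f1 (z.1.1, z.2.1) * f2 (z.1.2, z.2.2) *
    (gauss_pdf s z.1.1 * gauss_pdf s z.1.2 * (gauss_pdf e z.2.1 * gauss_pdf e z.2.2)).
  by rewrite /F !cgauss_pdfE// [RHS]mulrA.
have mF : measurable_fun setT F.
  rewrite (funext FE); apply: measurable_funM.
    apply: measurable_funM; apply: measurableT_comp => //.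
      by apply: measurable_fun_pair; apply: measurableT_comp.
    by apply: measurable_fun_pair; apply: measurableT_comp.
  by apply: measurable_funM; apply: measurable_funM;
    (apply: measurableT_comp; [exact: measurable_gauss|exact: measurableT_comp]).
(* The dominating function is the product of [(1 + h1^2)(1 + h2^2)] and the four densities. *)
have [w [iF _]] : exists w, has_integral (@leb4 R) F w.
  apply: has_integral_dominated mF
    (has_integral_prod (m1 := @leb2 R) (m2 := @leb2 R) U V) _ => z /=.
  rewrite FE normrM [X in _ * X]ger0_norm ?mulr_ge0 ?gauss_ge0//.
  rewrite [leRHS](_ : _ = (1 + z.1.1 ^+ 2) * (1 + z.1.2 ^+ 2) *
    (gauss_pdf s z.1.1 * gauss_pdf s z.1.2 * (gauss_pdf e z.2.1 * gauss_pdf e z.2.2)));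
    last by ring.
  rewrite ler_wpM2r ?mulr_ge0 ?gauss_ge0// normrM.
  by apply: ler_pM => //; exact: (b1 (z.1.1, z.2.1)).
(* [leb4] groups the coordinates as (h, n), not by pairs: for fixed [h] the noise integral splits
   into [phi1 h.1 * phi2 h.2], and then the integral over [h] splits too. *)
apply: (has_integral_iterated (m1 := @leb2 R) (m2 := @leb2 R) iF _
  (has_integral_prod (phi1v _ e1) (phi2v _ e2))) => h /=.
apply: has_integral_eq (has_integralZ (gauss_pdf s h.1 * gauss_pdf s h.2)
  (has_integral_prod (phi1E h.1) (phi2E h.2))) _ _; last by ring.
by move=> n /=; rewrite FE/=; ring.
Qed.

End gauss_factor.

(** * Sign moments, conditional means and the resulting error *)

Section mmse.
Variable R : realType.
Implicit Types (dh : R * R -> R) (e S kappa : R).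

Definition has_expect dh e (f : (R * R) * (R * R) -> R) (v : R) :=
  has_integral (@leb4 R) (fun z => f z * dh z.1 * cgauss_pdf e z.2) v.

Lemma expectE dh e f v : has_expect dh e f v -> expect dh e f = v%:E.
Proof. by case. Qed.

Lemma has_expect_eq dh e f g v w : has_expect dh e f v -> f =1 g -> v = w ->
  has_expect dh e g w.
Proof. by move=> fv /funext <- <-. Qed.

Lemma has_expectD dh e f g v w : has_expect dh e f v -> has_expect dh e g w ->
  has_expect dh e (fun z => f z + g z) (v + w).
Proof.
move=> fv gw; apply: has_integral_eq (has_integralD fv gw) _ erefl => z.
by rewrite !mulrDl.
Qed.

Lemma has_expectZ dh e f v (c : R) : has_expect dh e f v ->
  has_expect dh e (fun z => c * f z) (c * v).
Proof.
move=> fv; apply: has_integral_eq (has_integralZ c fv) _ erefl => z.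
by rewrite !mulrA.
Qed.

Lemma has_expect_mixture (K : nat) (p sig : 'I_K -> R) e f (v : 'I_K -> R) :
  (forall k, has_expect (cgauss_pdf (sig k)) e f (v k)) ->
  has_expect (gmm_pdf p sig) e f (\sum_(k < K) p k * v k).
Proof.
move=> fv; apply: has_integral_eq
  (has_integral_sum (index_enum 'I_K) (fun k => has_integralZ (p k) (fv k))) _ erefl.
move=> z; rewrite /gmm_pdf mulr_sumr mulr_suml; apply: eq_bigr => k _.
by rewrite !mulrA (mulrC (p k)).
Qed.

Definition sgn1 (z : (R * R) * (R * R)) := sgn (z.1.1 + z.2.1).
Definition sgn2 (z : (R * R) * (R * R)) := sgn (z.1.2 + z.2.2).

(** The booleans act as exponents and select one of the monomials 1, [sgn1], [sgn2], [sgn1 * sgn2],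
    which span all functions of the observation. The pattern of zeros is the same for every
    variance, so it survives mixing. *)
Definition sign_moments dh e kappa S :=
  [/\ forall b c : bool, has_expect dh e
        (fun z => sgn1 z ^+ b * sgn2 z ^+ c) (~~ b && ~~ c)%:R,
      forall b c : bool, has_expect dh e
        (fun z => z.1.1 * (sgn1 z ^+ b * sgn2 z ^+ c)) (kappa *+ (b && ~~ c)),
      forall b c : bool, has_expect dh e
        (fun z => z.1.2 * (sgn1 z ^+ b * sgn2 z ^+ c)) (kappa *+ (~~ b && c)) &
      has_expect dh e (fun z => z.1.1 ^+ 2 + z.1.2 ^+ 2) S].

(** Each moment factors over the independent coordinate pairs; a lone sign or a lone coordinate has
    mean zero and kills its product. *)
Lemma sign_moments_cgauss s e : 0 < s -> 0 < e ->
  sign_moments (cgauss_pdf s) e (s / Num.sqrt (pi * (s + e))) s.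
Proof.
move=> s0 e0; set kappa := s / _.
pose sg (b : bool) (z : R * R) : R := sgn (z.1 + z.2) ^+ b.
have gsg b f : quadratic_growth f -> quadratic_growth (fun z => f z * sg b z).
  case: b => gf; first exact: quadratic_growth_mul_sgn.
  by rewrite (_ : (fun z => _) = f)//; apply/funext => z; rewrite mulr1.
have g1 b : quadratic_growth (sg b).
  have := gsg b _ (@quadratic_growth1 R); congr quadratic_growth.
  by apply/funext => z; rewrite mul1r.
have gx := gsg _ _ (@quadratic_growth_fst R).
have E1 b : pair_expect s e (sg b) (~~ b)%:R.
  by case: b; [exact: pair_expect_sgn|exact: pair_expect1].
have Ex b : pair_expect s e (fun z => z.1 * sg b z) (kappa *+ b).
  case: b; first exact: pair_expect_corr.
  apply: has_integral_eq (pair_expect_mean s0 e0) _ erefl => z.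
  by rewrite /sg expr0 mulr1.
have g2 := @quadratic_growth_sqr R; have E2 := pair_expect_var s0 e0.
split.
- move=> b c; apply: has_expect_eq
    (has_integral_pairs s0 e0 (g1 b) (g1 c) (E1 b) (E1 c)) _ _ => //.
  by case: b; case: c; rewrite /= ?(mulr0n, mulr1n, mulr0, mul0r, mulr1, mul1r).
- move=> b c; apply: has_expect_eq
    (has_integral_pairs s0 e0 (gx b) (g1 c) (Ex b) (E1 c)) _ _.
    by move=> z; rewrite -mulrA.
  by case: b; case: c; rewrite /= ?(mulr0n, mulr1n, mulr0, mul0r, mulr1, mul1r).
- move=> b c; apply: has_expect_eq
    (has_integral_pairs s0 e0 (g1 b) (gx c) (E1 b) (Ex c)) _ _.
    by move=> z; rewrite /= mulrCA.
  by case: b; case: c; rewrite /= ?(mulr0n, mulr1n, mulr0, mul0r, mulr1, mul1r).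
- have g := g1 false; have E := E1 false.
  apply: has_expect_eq (has_expectD (has_integral_pairs s0 e0 g2 g E2 E)
    (has_integral_pairs s0 e0 g g2 E E2)) _ _.
    by move=> z; rewrite /sg/= !expr0 mulr1 mul1r.
  by rewrite mulr1 mul1r; field.
Qed.

Lemma sign_moments_mixture (K : nat) (p sig kappa S : 'I_K -> R) e :
  \sum_(k < K) p k = 1 ->
  (forall k, sign_moments (cgauss_pdf (sig k)) e (kappa k) (S k)) ->
  sign_moments (gmm_pdf p sig) e (\sum_(k < K) p k * kappa k) (\sum_(k < K) p k * S k).
Proof.
move=> p1 m; split=> [b c|b c|b c|].
- have m0 k : has_expect (cgauss_pdf (sig k)) e
      (fun z => sgn1 z ^+ b * sgn2 z ^+ c) (~~ b && ~~ c)%:R by case: (m k).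
  apply: has_expect_eq (has_expect_mixture p m0) _ _ => //.
  by rewrite -mulr_suml p1 mul1r.
- rewrite -sumrMnl; under eq_bigr do rewrite -mulrnAr.
  by apply: has_expect_mixture => k; case: (m k).
- rewrite -sumrMnl; under eq_bigr do rewrite -mulrnAr.
  by apply: has_expect_mixture => k; case: (m k).
- by apply: has_expect_mixture => k; case: (m k).
Qed.

(** For signs a and b, the indicator of a = b is (1 + a b)/2; the right-hand side is the product of
    two such factors. *)
Lemma indic_obs (z q : (R * R) * (R * R)) :
  Defs.indic R (obs z == obs q) =
  4^-1 * (1 + sgn1 q * sgn1 z + sgn2 q * sgn2 z + sgn1 q * sgn2 q * (sgn1 z * sgn2 z)).
Proof.
rewrite /obs /quant xpair_eqE /= -/(sgn1 z) -/(sgn2 z) -/(sgn1 q) -/(sgn2 q).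
have c0 : (Num.sqrt 2)^-1 != 0 :> R by rewrite invr_eq0 gt_eqF// sqrtr_gt0.
rewrite !(inj_eq (mulIf c0)).
have N : ((-1 : R) == 1) = false by apply/negbTE/eqP; lra.
have N' : ((1 : R) == -1) = false by rewrite eq_sym.
by rewrite /sgn1 /sgn2 /sgn; do 4 case: ifP => _; rewrite ?eqxx ?N ?N' /=; field.
Qed.

Lemma has_expect_indic dh e (f : (R * R) * (R * R) -> R) (q : (R * R) * (R * R))
    (v : bool -> bool -> R) :
  (forall b c : bool, has_expect dh e
     (fun z => f z * (sgn1 z ^+ b * sgn2 z ^+ c)) (v b c)) ->
  has_expect dh e (fun z => f z * Defs.indic R (obs z == obs q))
    (4^-1 * (v false false + sgn1 q * v true false + sgn2 q * v false true +
             sgn1 q * sgn2 q * v true true)).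
Proof.
move=> fv; apply: has_expect_eq (has_expectZ 4^-1 (has_expectD (has_expectD
  (has_expectD (fv false false) (has_expectZ (sgn1 q) (fv true false)))
  (has_expectZ (sgn2 q) (fv false true)))
  (has_expectZ (sgn1 q * sgn2 q) (fv true true)))) _ erefl => z.
by rewrite indic_obs; ring.
Qed.

(** Each quadrant has probability 1/4, and of the four sign terms only the one with coefficient
    [kappa] survives in each coordinate. The sample point [q] serves to range over attained
    observations. *)
Lemma cond_mean_sign dh e kappa S (q : (R * R) * (R * R)) :
  sign_moments dh e kappa S ->
  cond_mean dh e (obs q) = (kappa * sgn1 q, kappa * sgn2 q).
Proof.
move=> [m0 m1 m2 _]; rewrite /cond_mean.
have P := has_expect_indic (f := fun=> 1) q (v := fun b c => (~~ b && ~~ c)%:R).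
have {P} /expectE P : has_expect dh e (fun z => Defs.indic R (obs z == obs q)) 4^-1.
  apply: has_expect_eq (P _ _ _) _ _; last by rewrite /=; ring.
    by move=> b c; apply: has_expect_eq (m0 b c) _ erefl => z; rewrite mul1r.
  by move=> z; rewrite mul1r.
rewrite P (expectE (has_expect_indic q m1)) (expectE (has_expect_indic q m2)) /=.
by rewrite !mulr0n !mulr1n; congr (_, _); field.
Qed.

Lemma mmse_sign dh e kappa S : sign_moments dh e kappa S ->
  mmse dh e = (S - 2 * kappa ^+ 2)%:E.
Proof.
move=> m; have [m0 m1 m2 mS] := m; apply: expectE.
apply: has_expect_eq (has_expectD mS (has_expectD
  (has_expectZ (- 2 * kappa) (has_expectD (m1 true false) (m2 false true)))
  (has_expectZ (2 * kappa ^+ 2) (m0 false false)))) _ _ => [z|].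
  rewrite (cond_mean_sign _ m) /= !expr0 !expr1.
  (* The squared estimate is the constant [2 * kappa ^+ 2]; it is rewritten with squared signs to
     match the expanded square. *)
  have -> : 2 * kappa ^+ 2 * (1 * 1) =
      kappa ^+ 2 * (sgn1 z * sgn1 z) + kappa ^+ 2 * (sgn2 z * sgn2 z).
    by rewrite !sgn_sqr; ring.
  by ring.
by rewrite /=; ring.
Qed.

(** * Concavity of [s / sqrt (s + e)] and Jensen's inequality *)

(** The right-hand side is the tangent line at [t], with slope [(t/2 + e)/(t + e)^(3/2)]. *)
Lemma div_sqrt_tangent e s t : 0 < e -> 0 < s -> 0 < t ->
  s / Num.sqrt (s + e) <= t / Num.sqrt (t + e) +
    (t / 2 + e) / Num.sqrt (t + e) ^+ 3 * (s - t).
Proof.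
move=> e0 s0 t0.
set x := Num.sqrt (s + e); set y := Num.sqrt (t + e).
have x0 : 0 < x by rewrite sqrtr_gt0 addr_gt0.
have y0 : 0 < y by rewrite sqrtr_gt0 addr_gt0.
(* In terms of the two square roots the gap is rational, with the double root [x = y] of tangency
   and a positive cofactor. *)
have -> : s = x ^+ 2 - e by rewrite sqr_sqrtr ?addrK// ltW// addr_gt0.
have -> : t = y ^+ 2 - e by rewrite sqr_sqrtr ?addrK// ltW// addr_gt0.
rewrite -subr_ge0.
rewrite (_ : _ - _ = (x - y) ^+ 2 * (y ^+ 2 * x + e * (x + 2 * y)) / (2 * x * y ^+ 3)).
  by rewrite divr_ge0// mulr_ge0 ?sqr_ge0 ?addr_ge0 ?mulr_ge0 ?exprn_ge0
    ?addr_ge0 ?mulr_ge0 ?ltW.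
by field; rewrite !gt_eqF.
Qed.

Lemma mean_gt0 (K : nat) (p s : 'I_K -> R) :
  (forall k, 0 < p k) -> \sum_(k < K) p k = 1 -> (forall k, 0 < s k) ->
  0 < \sum_(k < K) p k * s k.
Proof.
case: K p s => [p s _|K p s p0 _ s0].
  (* An empty mixture would have total weight 0, not 1. *)
  by rewrite big_ord0 => /eqP; rewrite eq_sym oner_eq0.
rewrite big_ord_recl ltr_pwDl ?mulr_gt0// sumr_ge0// => k _.
by rewrite mulr_ge0// ltW.
Qed.

Lemma jensen_div_sqrt (K : nat) (p s : 'I_K -> R) e :
  (forall k, 0 < p k) -> \sum_(k < K) p k = 1 -> (forall k, 0 < s k) -> 0 < e ->
  \sum_(k < K) p k * (s k / Num.sqrt (s k + e)) <=
  (\sum_(k < K) p k * s k) / Num.sqrt (\sum_(k < K) p k * s k + e).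
Proof.
move=> p0 p1 s0 e0; set t := \sum_(k < K) p k * s k.
have t0 : 0 < t := mean_gt0 p0 p1 s0.
set c := (t / 2 + e) / Num.sqrt (t + e) ^+ 3.
(* The value at the mean is the average of the tangent line over the [s k], since the deviations
   [s k - t] average to zero; the tangent bound then applies termwise. *)
have -> : t / Num.sqrt (t + e) =
    \sum_(k < K) p k * (t / Num.sqrt (t + e) + c * (s k - t)).
  under eq_bigr => k _.
    rewrite (_ : _ * _ = p k * (t / Num.sqrt (t + e)) + c * (p k * s k - p k * t)).
      over.
    by ring.
  rewrite big_split/= -mulr_suml p1 mul1r -mulr_sumr sumrB -mulr_suml p1 mul1r.
  by rewrite subrr mulr0 addr0.
by apply: ler_sum => k _; rewrite ler_wpM2l ?(ltW (p0 k))//; exact: div_sqrt_tangent.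
Qed.

End mmse.

Theorem theorem3 (R : realType) (K : nat) (p sig : 'I_K -> R) (eta2 : R) :
  (forall k, 0 < p k) -> \sum_(k < K) p k = 1 ->
  (forall k, 0 < sig k) -> 0 < eta2 ->
  (mmse (cgauss_pdf (\sum_(k < K) p k * sig k)) eta2
     <= mmse (gmm_pdf p sig) eta2)%E.
Proof.
move=> p0 p1 sig0 e0.
have S0 := mean_gt0 p0 p1 sig0.
rewrite (mmse_sign (sign_moments_cgauss S0 e0)).
rewrite (mmse_sign (sign_moments_mixture p1 (fun k => sign_moments_cgauss (sig0 k) e0))).
have scale (s : R) : s / Num.sqrt (pi * (s + eta2)) =
    (Num.sqrt pi)^-1 * (s / Num.sqrt (s + eta2)).
  by rewrite sqrtrM ?pi_ge0// invfM mulrCA.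
have -> : \sum_(k < K) p k * (sig k / Num.sqrt (pi * (sig k + eta2))) =
    (Num.sqrt pi)^-1 * \sum_(k < K) p k * (sig k / Num.sqrt (sig k + eta2)).
  by rewrite mulr_sumr; apply: eq_bigr => k _; rewrite scale mulrCA.
(* The equal second moments cancel, and both values of [kappa] are nonnegative, so comparing their
   squares reduces to comparing them. *)
rewrite scale lee_fin lerD2l lerN2 ler_pM2l// ler_pXn2r ?nnegrE//.
- by rewrite ler_wpM2l ?invr_ge0 ?sqrtr_ge0// jensen_div_sqrt.
- rewrite mulr_ge0 ?invr_ge0 ?sqrtr_ge0// sumr_ge0// => k _.
  by rewrite mulr_ge0 ?divr_ge0 ?sqrtr_ge0 ?ltW.
- by rewrite mulr_ge0 ?divr_ge0 ?invr_ge0 ?sqrtr_ge0 ?ltW.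
Qed.
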